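(* Let $r\ge2$, let $K_r$ be the quiver with two vertices $1,2$ and $r$ arrows from $1$ to $2$, with mutation sequence $1,2,1,2,\dots$, and let $p=\frac{r+\sqrt{r^2-4}}2$. Let $S_\infty$ be the limit (as a formal power series) of the deformed $F$-polynomials $S_n$ as $n\to\infty$ with fixed parity. Let $\mathcal W$ be the set of (possibly empty) sequences $\mathbf w=(w_1,\dots,w_k)$ of integers with $0\le w_1\le\cdots\le w_k$ and $N_{1/p}(\mathbf w)\le1$. Then, up to a permutation of the variables $y_1,y_2$, $$S_\infty=\sum_{\mathbf w\in\mathcal W}\phi(\mathbf w)\prod_{i=1}^k\Big(s_{w_i}-\sum_{j=1}^{i-1}\big(s_{w_i-w_j}+s_{w_i-w_j-2}\big)\Big)\,y_1^{\sum_{i=1}^ks_{w_i}}\,y_2^{\sum_{i=1}^ks_{w_i-1}}.$$ Alternately, if $r\ge3$, then up to a permutation of the variables $y_1,y_2$, $$S_\infty=\sum_{\mathbf w\in\mathcal W}\phi(\mathbf w)\prod_{i=1}^k\Big(s_{w_i}-\sum_{j=1}^{i-1}\big(s_{w_i-w_j}+s_{w_i-w_j-2}\big)\Big)\,y_1^{\left\lfloor \frac{p\,N_p(\mathbf w)}{\sqrt{r^2-4}}\right\rfloor}\,y_2^{\left\lfloor \frac{N_p(\mathbf w)}{\sqrt{r^2-4}}\right\rfloor}.$$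
   Context: Quiver mutation at $k$: for every path $i\to k\to j$ add an arrow $i\to j$, reverse all arrows incident to $k$, then delete all 2-cycles. The framed quiver has additional frozen vertices $i'$ with one arrow $i'\to i$ for each base vertex $i$; only base vertices are mutated. Initially each base vertex has label $1$ and $i'$ has label $y_i$; mutating at $k$ replaces the label $V_k$ by (product of labels over arrows into $k$ + product of labels over arrows out of $k$, with multiplicity)$/V_k$. The $F$-polynomial $F_n$ is the label at the vertex mutated at step $n$, right after step $n$. The $C$-matrix $C_n$ is the invertible integer matrix whose $(i,j)$ entry is the number of arrows $i'\to j$ (negative if they go $j\to i'$) after $n$ mutations. For a square matrix $M$ and a polynomial $P$ in the $y_i$, $M(P)$ is obtained by replacing each monomial $y^e$ by $y^{Me}$; the deformed $F$-polynomial is $S_n=(-C_n^{-1})(F_n)$. Convergence means that each coefficient is eventually constant. The sequence $s$: $s_m=0$ for $m<0$, $s_0=1$, and $s_{k+2}=rs_{k+1}-s_k$ for $k\ge-1$. For a real $b>0$, the norm at $b$ of $\mathbf w$ is $N_b(\mathbf w)=\sum_{i=1}^kb^{w_i}$. $\phi(\mathbf w)$ is the number of distinct permutations of $w_1,\dots,w_k$ divided by $k!$ (so $\phi=1$ for the empty sequence, whose products are $1$). Sums are taken coefficientwise as formal power series in $y_1,y_2$. *)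

(* Defs.v *)
From HB Require Import structures.
From mathcomp Require Import all_boot all_order all_fingroup all_algebra.
From mathcomp Require Import classical_sets cardinality fsbigop reals.
From mathcomp Require Import mpoly.

Set Implicit Arguments.
Unset Strict Implicit.
Unset Printing Implicit Defensive.

Import Order.TTheory GRing.Theory Num.Theory.

Local Open Scope ring_scope.
Local Open Scope classical_set_scope.

(* [q i j] is the number of arrows i -> j. *)
Definition quiver (V : finType) := V -> V -> nat.

Section Mutation.
Variable V : finType.
Implicit Types (q : quiver V) (k : V).

Definition add_paths k q : quiver V :=
  fun i j => (q i j + q i k * q k j)%N.

Definition reverse_at k q : quiver V :=
  fun i j => if (i == k) || (j == k) then q j i else q i j.

(* Truncated subtraction: of the arrows between i and j, only the excess in
   one direction survives. *)
Definition delete_2cycles q : quiver V :=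
  fun i j => (q i j - q j i)%N.

Definition mutate k q : quiver V :=
  delete_2cycles (reverse_at k (add_paths k q)).

Definition mutate_label (K : fieldType) k q (L : V -> K) : V -> K :=
  fun v => if v == k then
      (\prod_(i : V) L i ^+ q i k + \prod_(j : V) L j ^+ q k j) / L k
    else L v.

End Mutation.

Section Framed.
Variable n : nat.

(* [inl i] is the base vertex i and [inr i] the frozen vertex i'. *)
Definition framed_vertex : finType := ('I_n + 'I_n)%type.

Definition framed (Q : quiver 'I_n) : quiver framed_vertex :=
  fun u v => match u, v with
  | inl i, inl j => Q i j
  | inr i, inl j => (i == j) : nat
  | _, _ => 0%N
  end.

Definition label_field : fieldType := {fraction {mpoly rat[n]}}.

Definition framed_label (v : framed_vertex) : label_field :=
  match v with inl _ => 1 | inr i => tofrac ('X_i : {mpoly rat[n]}) end.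

Variables (Q : quiver 'I_n) (mu : nat -> 'I_n).

(* The framed quiver and its labels after t mutations; steps are numbered from
   1, and step t mutates at [mu t], so that [mu 0] is never used. *)
Fixpoint seed (t : nat) : quiver framed_vertex * (framed_vertex -> label_field) :=
  match t with
  | 0 => (framed Q, framed_label)
  | t'.+1 => let: (q, L) := seed t' in
      (mutate (inl (mu t)) q, mutate_label (inl (mu t)) q L)
  end.

(* The polynomial equal to the label, as an element of the fraction field
   (unique since [tofrac] is injective). *)
Definition F_poly (t : nat) : {mpoly rat[n]} :=
  xget 0 [set P | tofrac P = (seed t).2 (inl (mu t))].

Definition C_matrix (t : nat) : 'M[int]_n :=
  \matrix_(i, j) (((seed t).1 (inr i) (inl j))%:Z
                  - ((seed t).1 (inl j) (inr i))%:Z).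

(* Formal series with integer exponents: the value at [v] is the coefficient
   of y^v. *)
Definition laurent := 'cV[int]_n -> rat.

Definition mx_act (M : 'M[int]_n) (P : {mpoly rat[n]}) : laurent :=
  fun v => \sum_(m <- msupp P | M *m (\col_i (m i)%:Z) == v) P@_m.

Definition deformed_F (t : nat) : laurent :=
  mx_act (- invmx (C_matrix t)) (F_poly t).

End Framed.

Section Series.
Variable n : nat.
Implicit Type S : laurent n.

Definition is_power_series S :=
  forall v : 'cV[int]_n, (exists i, v i 0 < 0) -> S v = 0.

(* Coefficientwise eventual constancy of S_t along the t with [odd t = b]. *)
Definition parity_limit (b : bool) (Sn : nat -> laurent n) S :=
  forall v, exists N : nat,
    forall t, (N <= t)%N -> odd t = b -> Sn t v = S v.

Definition permute_vars (sigma : 'S_n) S : laurent n :=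
  fun v => S (row_perm sigma v).

(* S = \sum_(w in W) c w * y^(e w), only finitely many w contributing to
   each monomial. *)
Definition is_formal_sum (I : choiceType) (W : set I) (c : I -> rat)
    (e : I -> 'cV[int]_n) S :=
  forall v, finite_set (W `&` [set w | e w = v])
    /\ S v = \sum_(w \in W `&` [set w | e w = v]) c w.

End Series.

Definition vertex1 : 'I_2 := ord0.
Definition vertex2 : 'I_2 := ord_max.

Definition kronecker (r : nat) : quiver 'I_2 :=
  fun i j => if (i == vertex1) && (j == vertex2) then r else 0%N.

(* Step 1 is at vertex 1, step 2 at vertex 2, and so on. *)
Definition alternating (t : nat) : 'I_2 := if odd t then vertex1 else vertex2.

Fixpoint s_nat (r k : nat) : int :=
  match k with
  | 0 => 1
  | 1 => r%:Z
  | (k'.+1 as k1).+1 => r%:Z * s_nat r k1 - s_nat r k'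
  end.

Definition s_seq (r : nat) (m : int) : int :=
  match m with Posz k => s_nat r k | Negz _ => 0 end.

Lemma s_seq_rec (r : nat) (k : int) : -1 <= k ->
  s_seq r (k + 2) = r%:Z * s_seq r (k + 1) - s_seq r k.
Proof.
case: k => [k|[|k]] //= _; last by rewrite mulr1 subr0.
by rewrite addn2 addn1.
Qed.

Definition norm_at (R : realType) (b : R) (w : seq nat) : R :=
  \sum_(x <- w) b ^+ x.

Definition phi (w : seq nat) : rat :=
  (size (permutations w))%:R / ((size w)`!)%:R.

Definition p_root (R : realType) (r : nat) : R :=
  (r%:R + Num.sqrt (r%:R ^+ 2 - 4)) / 2.

Definition W_set (R : realType) (r : nat) : set (seq nat) :=
  [set w | sorted leq w /\ norm_at (1 / p_root R r) w <= 1].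

Definition term_coef (r : nat) (w : seq nat) : rat :=
  let wi i : int := (nth 0%N w i)%:Z in
  phi w * \prod_(i < size w)
    (s_seq r (wi i)
     - \sum_(j < i) (s_seq r (wi i - wi j) + s_seq r (wi i - wi j - 2)))%:~R.

Definition monomial2 (a b : int) : 'cV[int]_2 :=
  \col_i (if i == vertex1 then a else b).

Definition exponent (r : nat) (w : seq nat) : 'cV[int]_2 :=
  monomial2 (\sum_(x <- w) s_seq r x%:Z) (\sum_(x <- w) s_seq r (x%:Z - 1)).

Definition exponent_floor (R : realType) (r : nat) (w : seq nat) : 'cV[int]_2 :=
  let p := p_root R r in
  let d : R := Num.sqrt (r%:R ^+ 2 - 4) in
  monomial2 (Num.floor (p * norm_at p w / d)) (Num.floor (norm_at p w / d)).

(* Main.v *)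
Require Import Defs.
From mathcomp Require Import all_boot all_order all_fingroup all_algebra.
From mathcomp Require Import classical_sets reals.
From mathcomp Require Import functions cardinality fsbigop boolp mpoly.
From mathcomp Require Import zify ring lra.

Set Implicit Arguments.
Unset Strict Implicit.
Unset Printing Implicit Defensive.
Import Order.TTheory GRing.Theory Num.Theory.
Local Open Scope ring_scope.
Local Open Scope classical_set_scope.

(** Let u_0 = 0, u_1 = 1 and u_(k+2) = r u_(k+1) - u_k, so that s_k = u_(k+1).
Along the mutation sequence the F-polynomials satisfy F_(-1) = F_0 = 1 and
    F_(t+1) F_(t-1) = F_t ^ r + y ^ c_t,    c_t = (u_(t+1), u_t),
and for t >= 1 the two columns of C_t are c_t and - c_(t-1) ([seed_shapeP]).

Why a sum over words appears.  The exchange relation says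
F_t = (F_(t-1) ^ r / F_(t-2)) (1 + y ^ c_(t-1) / F_(t-1) ^ r), so the binomial
series rewrites F_t ^ E F_(t-1) ^ D as the sum over m of
    binom(E, m) y ^ (m c_(t-1)) F_(t-1) ^ (r (E - m) + D) F_(t-2) ^ (- E).
Starting from E = 1, D = 0 and iterating until F_0 = F_(-1) = 1 is reached
([exchange_expansion]) writes F_t as a sum over tuples (m_0, ..., m_(t-1)) of
prod_v binom(E_v, m_v) y ^ (m_v c_(t-1-v)).  A tuple is the same thing as the
sorted word with m_v letters v; the recursion for the exponents is solved by
E_v = s_v - sum_(j < v) m_j (s_(v-j) + s_(v-j-2)), which makes the product of the
binomial coefficients the coefficient of that word in the theorem
([term_coefE]).  The exponents E_v may be negative, so these manipulations take
place in the fraction field, modulo elements of high order in y_1.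

Why the limit exists.  Up to exchanging the variables when t is even, - C_t ^ (-1)
sends c_(t-1-v) to (s_v, s_(v-1)) ([word_expE]).  Hence the deformed polynomial
S_t is the sum over the sorted words with letters below t of terms which do not
depend on t, and only finitely many words contribute to a given monomial.

Why the norm condition appears.  If the word w has exponent (e_1, e_2), then
N_(1/p)(w) = e_1 - p e_2 depends on the monomial only.  The polynomial F_t has
degree u_t in y_1 ([F_spec_size]); in the deformed variables this reads
u_t e_1 - u_(t+1) e_2 <= u_t, and u_(t+1) / u_t tends to p, so that the monomials
with e_1 - p e_2 > 1 have coefficient 0 in the limit ([S_inf_support]): the words
outside W cancel out.

Finally, with d = sqrt (r ^ 2 - 4) = p - 1/p, one has
p N_p(w) / d = e_1 + N_(1/p)(w) / (p d) and N_p(w) / d = e_2 + N_(1/p)(w) / d.  For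
r >= 3 and w in W both remainders lie in [0, 1), so the floors are e_1 and e_2
([exponent_floorE]). *)

(** * The Chebyshev recursion *)

Fixpoint chebyshev (r k : nat) : nat :=
  match k with
  | 0 => 0
  | 1 => 1
  | (k'.+1 as k1).+1 => (r * chebyshev r k1 - chebyshev r k')%N
  end.

Section Chebyshev.
Variable r : nat.
Hypothesis hr : (2 <= r)%N.
Local Notation u := (chebyshev r).

Lemma chebyshevSS k : u k.+2 = (r * u k.+1 - u k)%N.
Proof. by []. Qed.

Lemma chebyshev_lt k : (u k < u k.+1)%N.
Proof.
elim: k => // k IHk; rewrite chebyshevSS.
have : (2 * u k.+1 <= r * u k.+1)%N by rewrite leq_mul2r hr orbT.
by move: IHk; lia.
Qed.

Lemma chebyshev_rec k : (u k.+2 + u k = r * u k.+1)%N.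
Proof.
rewrite chebyshevSS subnK //.
apply: (leq_trans (ltnW (chebyshev_lt k))).
by rewrite leq_pmull //; lia.
Qed.

Lemma chebyshev_ge k : (k <= u k)%N.
Proof. by elim: k => // k IHk; apply: leq_ltn_trans IHk (chebyshev_lt k). Qed.

Lemma s_natE k : s_nat r k = (u k.+1)%:Z.
Proof.
suff: s_nat r k = (u k.+1)%:Z /\ s_nat r k.+1 = (u k.+2)%:Z by case.
elim: k => [|k [IH1 IH2]]; first by split; rewrite //= muln1 subn0.
split=> //.
have -> : s_nat r k.+2 = r%:Z * s_nat r k.+1 - s_nat r k by [].
by rewrite IH1 IH2 -PoszM -chebyshev_rec PoszD addrK.
Qed.

Lemma s_seqE (k : nat) : s_seq r k = (u k.+1)%:Z.
Proof. exact: s_natE. Qed.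

Lemma s_seq_pred (k : nat) : s_seq r (k%:Z - 1) = (u k)%:Z.
Proof.
case: k => [|k] //; have -> : k.+1%:Z - 1 = k%:Z by lia.
exact: s_natE.
Qed.

(** By the recursion, shifting [t] and [z] together changes neither side.  For
[z = t.-1] this gives the determinant of the C-matrices up to sign. *)
Lemma chebyshev_det t z : (z <= t)%N ->
  (u t)%:Z * (u z.+1)%:Z - (u t.+1)%:Z * (u z)%:Z = (u (t - z))%:Z :> int.
Proof.
elim: z t => [|z IHz] t; first by rewrite subn0 /= mulr1 mulr0 subr0.
case: t => // t; rewrite ltnS subSS => zt; rewrite -IHz //.
have := chebyshev_rec z; have := chebyshev_rec t; nia.
Qed.
End Chebyshev.

(** * Seeds of the framed Kronecker quiver *)

Section Seeds.
Variable r : nat.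
Hypothesis hr : (2 <= r)%N.
Local Notation u := (chebyshev r).
Local Notation K := (label_field 2).

Definition c_exp (t : nat) : 'X_{1..2} :=
  [multinom if i == vertex1 then u t.+1 else u t | i < 2].

Definition c_mon (t : nat) : {mpoly rat[2]} := 'X_[c_exp t].

(** The index is shifted by one: [F_label t.+1] is the label created at step [t],
so that the two initial labels are [F_label 0] and [F_label 1]. *)
Fixpoint F_label (t : nat) : K :=
  match t with
  | 0 => 1
  | 1 => 1
  | (t'.+1 as t1).+1 => (tofrac (c_mon t') + F_label t1 ^+ r) / F_label t'
  end.

Arguments F_label : simpl never.

Lemma F_labelSS t :
  F_label t.+2 = (tofrac (c_mon t) + F_label t.+1 ^+ r) / F_label t.
Proof. by []. Qed.

Lemma alternatingSS t : alternating t.+2 = alternating t.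
Proof. by rewrite /alternating /= negbK. Qed.

Lemma alternating_neq t : alternating t.+1 != alternating t.
Proof. by rewrite /alternating /=; case: odd. Qed.

Lemma alternating_ind t (P : 'I_2 -> Prop) :
  P (alternating t.+1) -> P (alternating t) -> forall x, P x.
Proof.
rewrite /alternating /=; case: (odd t) => /= P1 P2 x;
by have : x = vertex1 \/ x = vertex2; [
  case: x => -[|[|//]] i; [left|right]; exact: val_inj |case=> ->].
Qed.

Lemma c_mon_frac t :
  tofrac (c_mon t) = \prod_(i < 2) (tofrac ('X_i : {mpoly rat[2]})) ^+ c_exp t i.
Proof.
by rewrite /c_mon mpolyXE_id rmorph_prod; apply: eq_bigr => i _; rewrite rmorphXn.
Qed.

(** After [t] steps, [v] is the vertex about to be mutated and [o] the one mutated
last.  At [t = 0] the frozen arrow at [o] still has its initial direction, hence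
the two matches on [t]. *)
Definition seed_shape (t : nat) (s : quiver (framed_vertex 2) * (framed_vertex 2 -> K)) :=
  let v := alternating t.+1 in let o := alternating t in
  [/\ [/\ s.1 (inl v) (inl o) = r, s.1 (inl o) (inl v) = 0%N
        & forall x, s.1 (inl x) (inl x) = 0%N],
      forall i, s.1 (inr i) (inl v) = c_exp t i /\ s.1 (inl v) (inr i) = 0%N,
      forall i, s.1 (inr i) (inl o) = (if t is 0 then (i == vertex2) : nat else 0%N)
        /\ s.1 (inl o) (inr i) = (if t is t'.+1 then c_exp t' i else 0%N),
      forall i j, s.1 (inr i) (inr j) = 0%N
    & [/\ s.2 (inl v) = F_label t, s.2 (inl o) = F_label t.+1
        & forall i, s.2 (inr i) = tofrac ('X_i : {mpoly rat[2]})]].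

Lemma seed_shape0 : seed_shape 0 (seed (kronecker r) alternating 0).
Proof.
split; rewrite /= /alternating /kronecker //=.
by split=> // -[[|[|//]] ?].
by move=> i; rewrite /c_exp mnmE; case: (i == vertex1).
Qed.

Lemma big_framed (x : 'I_2) (y : 'I_2) (G : framed_vertex 2 -> K) : x != y ->
  \prod_i G i = G (inl x) * G (inl y) * \prod_i G (inr i).
Proof.
move=> xy; rewrite big_sumType /=; congr (_ * _).
by rewrite (bigD1 x) //= (bigD1 y) 1?eq_sym //= big1 ?mulr1 // => i;
  move: x y i xy => [[|[|//]]?] [[|[|//]]?] [[|[|//]]?].
Qed.

Lemma c_exp_rec t i : (c_exp t.+2 i + c_exp t i = r * c_exp t.+1 i)%N.
Proof. by rewrite !mnmE; case: ifP => _; apply: chebyshev_rec. Qed.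

(** Mutating at [v] adds [r] times the column [c_exp t] to the column of [o], which
is [- c_exp t.-1] for [t > 0] and [(0, 1)] for [t = 0]; in both cases the result is
[c_exp t.+1].  No arrow between frozen vertices appears, because all frozen arrows
at [v] point towards it. *)
Lemma seed_shapeP t : seed_shape t (seed (kronecker r) alternating t).
Proof.
elim: t => [|t IH]; first exact: seed_shape0.
rewrite [seed _ _ _]/=; move: IH; case: (seed _ _ t) => q L.
case=> /= -[qvo qov qxx] qfv qfo qff [Lv Lo Lf].
rewrite /seed_shape /= alternatingSS.
set v := alternating t.+1 in qvo qov qfv Lv *; set o := alternating t in qvo qov qfo Lo *.
have vo : v != o by apply: alternating_neq.
have inlE (a b : 'I_2) : ((inl a : framed_vertex 2) == inl b) = (a == b) by [].
have inrE (a b : 'I_2) : ((inr a : framed_vertex 2) == inl b) = false by [].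
have ov : (o == v) = false by rewrite eq_sym; apply: negbTE.
split.
- rewrite /mutate /delete_2cycles /reverse_at /add_paths !inlE !eqxx ov !orbT /=.
  rewrite qvo qov !qxx; split; lia.
- move=> i; rewrite /mutate /delete_2cycles /reverse_at /add_paths !inlE !inrE ?eqxx ov /=.
  have [q1 q2] := qfv i; have [q3 q4] := qfo i.
  rewrite q1 q2 q3 q4 qvo qov mul0n addn0 mulnC.
  case: (t) => [|t'].
    by rewrite !mnmE; move: i {q1 q2 q3 q4} => [[|[|//]]?] /=; lia.
  by have := c_exp_rec t' i; split; lia.
- move=> i; rewrite /mutate /delete_2cycles /reverse_at /add_paths !inlE !inrE ?eqxx ?orbT /=.
  have [q1 q2] := qfv i.
  rewrite q1 q2 !qxx; lia.
- move=> i j; rewrite /mutate /delete_2cycles /reverse_at /add_paths !inrE /=.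
  have [_ q2] := qfv i; have [_ q4] := qfv j; rewrite q2 q4 !qff; lia.
rewrite /mutate_label !inlE eqxx ov Lo Lv; split=> //.
rewrite F_labelSS !(big_framed _ vo) !qxx qov qvo Lo c_mon_frac !expr0 !mul1r; congr ((_ + _) / _).
  by apply: eq_bigr => i _; rewrite (qfv i).1 Lf.
by rewrite big1 ?mulr1 // => i _; rewrite (qfv i).2 expr0.
Qed.

Lemma seed_label t : (seed (kronecker r) alternating t).2 (inl (alternating t)) = F_label t.+1.
Proof. by have [_ _ _ _ []] := seed_shapeP t. Qed.

Lemma C_matrix_next t i :
  C_matrix (kronecker r) alternating t.+1 i (alternating t) = c_exp t.+1 i.
Proof.
have [_ /(_ i) + _ _ _] := seed_shapeP t.+1.
by rewrite alternatingSS mxE => -[-> ->]; rewrite subr0.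
Qed.

Lemma C_matrix_last t i :
  C_matrix (kronecker r) alternating t.+1 i (alternating t.+1) = - (c_exp t i)%:Z.
Proof.
have [_ _ /(_ i) + _ _] := seed_shapeP t.+1.
by rewrite mxE => -[-> ->]; rewrite sub0r.
Qed.
End Seeds.

(** * Polynomiality of the labels *)

Lemma exprD_congr (R : comNzRingType) (x y : R) n :
  exists z, (x + y) ^+ n = x ^+ n + y * z.
Proof.
elim: n => [|n [z IH]]; first by exists 0; rewrite mulr0 addr0 !expr0.
by exists (x ^+ n + (x + y) * z); rewrite !exprS IH; ring.
Qed.

Section MonomialDivision.
Variables (n : nat) (k : fieldType).
Implicit Types (P G H : {mpoly k[n]}) (c m : 'X_{1..n}).

Lemma mpolyX_dvd c G : (forall m, ~~ (c <= m)%MM -> G@_m = 0) ->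
  exists G', G = 'X_[c] * G'.
Proof.
move=> cG; exists (\sum_(m <- msupp G) G@_m *: 'X_[(m - c)%MM]).
rewrite {1}(mpolyE G) mulr_sumr; apply: eq_big_seq => m mG.
have cm : (c <= m)%MM.
  by apply: contraLR mG => /cG Gm; rewrite mcoeff_msupp Gm eqxx.
by rewrite -scalerAr -mpolyXD addmC submK.
Qed.

Lemma mcoeffMX0 c H m : ~~ (c <= m)%MM -> ('X_[c] * H)@_m = 0.
Proof.
move=> cm; rewrite -commr_mpolyX; apply/eqP; rewrite mcoeff_eq0.
rewrite (perm_mem (msuppMX _ _)); apply: contra cm => /mapP[m' _ ->].
exact: lem_addr.
Qed.

(** A form of Gauss's lemma: a monomial is coprime to a polynomial with nonzero
constant term.  Looking at the coefficients of [P * G] by increasing degree, every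
monomial of [G] must be a multiple of [c]. *)
Lemma mpolyX_Gauss P G H c : P@_0%MM != 0 -> 'X_[c] * H = P * G ->
  exists G', H = P * G'.
Proof.
move=> P0 E; suff /mpolyX_dvd[G' GE] : forall m, ~~ (c <= m)%MM -> G@_m = 0.
  exists G'; apply/(@mulfI _ ('X_[c] : {mpoly k[n]})); first by rewrite -msupp_eq0 msuppX.
  by rewrite E GE mulrCA.
move=> m; have [d] := ubnP (mdeg m); elim: d m => // d IHd m md cm.
have := mcoeffMX0 H cm; rewrite E mcoeffM.
rewrite (bigD1 (bm0, BMultinom (ltnSn (mdeg m)))) /= ?add0m //.
rewrite big1 ?addr0 => [/eqP|[[k1 kd1] [k2 kd2]] /= /andP[/eqP mE kN]].
  by rewrite mulf_eq0 (negbTE P0) => /eqP.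
rewrite IHd ?mulr0 //.
  suff : (0 < mdeg k1)%N by move: md; rewrite mE mdegD; lia.
  rewrite lt0n mdeg_eq0; apply: contra kN => /eqP k10.
  by rewrite xpair_eqE !bmeqP /= mE k10 add0m !eqxx.
by apply: contra cm => ck; rewrite mE (lepm_trans ck) // lem_addl.
Qed.
End MonomialDivision.

Section Laurent.
Variable r : nat.
Hypothesis hr : (2 <= r)%N.
Local Notation A := {mpoly rat[2]}.
Local Notation X := ('X_vertex1 : A).

(** These polynomials become units once localized at the ideal of [y_1]; they also
have constant term [1], as [mpolyX_Gauss] requires. *)
Definition one_mod_X (P : A) := exists G, P = 1 + X * G.

Lemma one_mod_X1 : one_mod_X 1.
Proof. by exists 0; rewrite mulr0 addr0. Qed.

Lemma one_mod_XM P Q : one_mod_X P -> one_mod_X Q -> one_mod_X (P * Q).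
Proof. by move=> [G ->] [H ->]; exists (G + H + X * G * H); ring. Qed.

Lemma one_mod_XX P n : one_mod_X P -> one_mod_X (P ^+ n).
Proof.
move=> PX; elim: n => [|n IH]; first by rewrite expr0; apply: one_mod_X1.
by rewrite exprS; apply: one_mod_XM.
Qed.

Lemma one_mod_XD P G : one_mod_X P -> one_mod_X (P + X * G).
Proof. by move=> [H ->]; exists (H + G); ring. Qed.

Lemma one_mod_X_coef0 P : one_mod_X P -> P@_0%MM = 1.
Proof.
move=> [G ->]; rewrite mcoeffD mcoeff1 eqxx mcoeffMX0 ?addr0 //.
by apply/negP => /mnm_lepP/(_ vertex1); rewrite mnm1E mnm0E eqxx.
Qed.

Lemma one_mod_X_neq0 P : one_mod_X P -> P != 0.
Proof.
move=> /one_mod_X_coef0 P0; apply/eqP => PE; move/eqP: P0.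
by rewrite PE mcoeff0 eq_sym oner_eq0.
Qed.

Lemma one_mod_X_cancel P Q : one_mod_X Q -> one_mod_X (P * Q) -> one_mod_X P.
Proof.
by move=> [G ->] [H E]; exists (H - P * G); rewrite mulrBr addrA -E; ring.
Qed.

Lemma c_exp1_gt0 t : (0 < c_exp r t vertex1)%N.
Proof. by rewrite mnmE /=; apply: leq_ltn_trans (chebyshev_lt hr t). Qed.

Lemma c_mon_dvdX t : exists G, c_mon r t = X * G.
Proof.
apply: mpolyX_dvd => m; rewrite /c_mon mcoeffX; case: eqP => // <-.
by rewrite lep1mP -lt0n c_exp1_gt0.
Qed.

Lemma c_mon_rec t : c_mon r t.+2 * c_mon r t = c_mon r t.+1 ^+ r.
Proof.
rewrite /c_mon mpolyXn -mpolyXD; congr 'X_[_]; apply/mnmP => i.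
by rewrite mnmDE mulmnE c_exp_rec // mulnC.
Qed.

(** Membership in [1 + y_1 A] is carried along because the next division step needs
it. *)
Definition F_spec t (P : A) := one_mod_X P /\ tofrac P = F_label r t.

Lemma F_spec_exchange t P0 P1 P2 :
  F_spec t P0 -> F_spec t.+1 P1 -> F_spec t.+2 P2 ->
  P2 * P0 = c_mon r t + P1 ^+ r.
Proof.
move=> [P0X P0E] [_ P1E] [_ P2E]; apply/eqP; rewrite -tofrac_eq.
rewrite tofracM tofracD tofracXn P0E P1E P2E F_labelSS mulfVK //.
by rewrite -P0E tofrac_eq0 one_mod_X_neq0.
Qed.

Lemma F_spec_next t P0 P1 P2 : F_spec t P0 -> F_spec t.+1 P1 ->
  P2 * P0 = c_mon r t + P1 ^+ r -> F_spec t.+2 P2.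
Proof.
move=> [P0X P0E] [P1X P1E] E; split.
  apply: (one_mod_X_cancel P0X); rewrite E addrC.
  by have [G ->] := c_mon_dvdX t; apply/one_mod_XD/one_mod_XX.
have P0n : tofrac P0 != 0 by rewrite tofrac_eq0 one_mod_X_neq0.
apply: (mulIf P0n); rewrite F_labelSS -P0E -P1E mulfVK //.
by rewrite -tofracM E tofracD tofracXn.
Qed.

(** The Laurent phenomenon in rank two.  Write [P0, ..., P3] for four consecutive
polynomials.  Modulo [P2] the exchange relations give [P1 ^ r = - c_mon t] and
[P3 * P1 = c_mon t.+1], whence
[c_mon t * P3 ^ r = - c_mon t.+1 ^ r = - c_mon t * c_mon t.+2].  So [P2] divides
[c_mon t * (c_mon t.+2 + P3 ^ r)], and the monomial can be cancelled. *)
Lemma F_spec_ex t : exists P, F_spec t P.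
Proof.
suff : exists P0 P1 P2 P3,
    [/\ F_spec t P0, F_spec t.+1 P1, F_spec t.+2 P2 & F_spec t.+3 P3].
  by move=> [P0 [_ [_ [_ [? _ _ _]]]]]; exists P0.
elim: t => [|t [P0 [P1 [P2 [P3 [S0 S1 S2 S3]]]]]].
  have S0 : F_spec 0 1 by split; [exact: one_mod_X1|rewrite tofrac1].
  have S1 : F_spec 1 1 by split; [exact: one_mod_X1|rewrite tofrac1].
  have S2 := F_spec_next S0 S1 (mulr1 _).
  have S3 := F_spec_next S1 S2 (mulr1 _).
  by do 4!eexists; split; eassumption.
suff [P4 E4] : exists P4, c_mon r t.+2 + P3 ^+ r = P2 * P4.
  exists P1, P2, P3, P4; split=> //.
  by apply: F_spec_next S2 S3 _; rewrite E4 mulrC.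
have E2 := F_spec_exchange S0 S1 S2; have E3 := F_spec_exchange S1 S2 S3.
have P20 : P2@_0%MM != 0 by rewrite (one_mod_X_coef0 S2.1) oner_eq0.
have [n rE] : exists n, r = n.+1 by exists r.-1; lia.
suff [G EG] : exists G, c_mon r t * (c_mon r t.+2 + P3 ^+ r) = P2 * G.
  exact: (mpolyX_Gauss P20 EG).
have [B EB] : exists B, (P3 * P1) ^+ r = c_mon r t.+1 ^+ r + P2 * B.
  have [z zE] := exprD_congr (c_mon r t.+1) (P2 ^+ r) r.
  by exists (P2 ^+ n * z); rewrite E3 zE mulrA -exprS -rE.
exists (P3 ^+ r * P0 - B).
have -> : P2 * (P3 ^+ r * P0 - B) = P3 ^+ r * (P2 * P0) - P2 * B by ring.
rewrite E2 mulrDr [c_mon r t * _]mulrC c_mon_rec [P3 ^+ r * _]mulrDr -exprMn EB.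
by ring.
Qed.

Lemma F_poly_spec t : F_spec t.+1 (F_poly (kronecker r) alternating t).
Proof.
have [P [PX PE]] := F_spec_ex t.+1.
rewrite /F_poly; case: xgetP => [Q _ /= QE|/(_ P)]; last first.
  by rewrite /= seed_label.
rewrite seed_label // in QE; suff -> : Q = P by [].
by apply/eqP; rewrite -tofrac_eq QE PE.
Qed.
End Laurent.

(** * Binomial series with integer exponents *)

(** The generalized binomial coefficient with an integer, possibly negative, upper
argument. *)
Definition binomz (E : int) (m : nat) : rat :=
  (\prod_(l < m) (E - l%:Z)%:~R) / (m`!)%:R.

Lemma binomz0 E : binomz E 0 = 1.
Proof. by rewrite /binomz big_ord0 fact0 divr1. Qed.

Lemma binomz_Pascal E m : binomz (E + 1) m.+1 = binomz E m.+1 + binomz E m.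
Proof.
rewrite /binomz big_ord_recl big_ord_recr /=.
have -> : \prod_(i < m) (E + 1 - (bump 0 i)%:Z)%:~R = \prod_(i < m) (E - i%:Z)%:~R :> rat.
  by apply: eq_bigr => i _; congr (_%:~R); rewrite /bump /=; lia.
set P := \prod_(i < m) _; rewrite factS natrM subr0.
have m0 : (m`!)%:R != 0 :> rat by rewrite pnatr_eq0 -lt0n fact_gt0.
have m1 : (m.+1)%:R != 0 :> rat by rewrite pnatr_eq0.
rewrite !intrD intrN -!pmulrn /=; move: m1; rewrite -natr1 => m1.
by field; rewrite m0 m1.
Qed.

(** [I D] plays the part of the ideal of elements of order at least [D] in a
local ring lying inside its field of fractions.  The last two laws are the ones
which make [1 + I 1] a group of units, so that integer powers of its elements,
negative ones included, never leave [I 0].  This is all of the theory of formal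
power series that the expansion below relies on. *)
Record adic_filtration (K : fieldType) (I : nat -> K -> Prop) (inj : rat -> K)
    : Prop := AdicFiltration {
  adic_0 : forall D, I D 0;
  adic_1 : I 0 1;
  adic_scalar : forall c, I 0 (inj c);
  adic_sub : forall D x y, I D x -> I D y -> I D (x - y);
  adic_mul : forall D D' x y, I D x -> I D' y -> I (D + D')%N (x * y);
  adic_weaken : forall D x, I D.+1 x -> I D x;
  adic_inv : forall x, I 1 x -> 1 + x != 0 /\ I 0 (1 + x)^-1
}.

Section Filtration.
Variables (K : fieldType) (I : nat -> K -> Prop) (inj : {rmorphism rat -> K}).
Variable FI : adic_filtration I inj.
Let I0 := adic_0 FI.
Let I1 := adic_1 FI.
Let Iinj := adic_scalar FI.
Let IB := adic_sub FI.
Let IM := adic_mul FI.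
Let Iinv := adic_inv FI.
Let IS := adic_weaken FI.

Lemma filtD D x y : I D x -> I D y -> I D (x + y).
Proof. by move=> Ix Iy; rewrite -[y]opprK -[- y]sub0r; do 2!apply: IB => //. Qed.

Lemma filtMl D x y : I 0 x -> I D y -> I D (x * y).
Proof. exact: IM. Qed.

Lemma filtMr D x y : I D x -> I 0 y -> I D (x * y).
Proof. by move=> Ix Iy; rewrite mulrC; apply: filtMl. Qed.

Lemma filt_sum D (J : eqType) (s : seq J) (F : J -> K) :
  (forall i, i \in s -> I D (F i)) -> I D (\sum_(i <- s) F i).
Proof. by move=> H; rewrite big_seq; apply: big_ind => //; apply: filtD. Qed.

Lemma filtX D x : I 1 x -> I D (x ^+ D).
Proof.
move=> Ix; elim: D => [|D IHD]; first by rewrite expr0.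
by rewrite exprS -add1n; apply: IM.
Qed.

Lemma filt0X n x : I 0 x -> I 0 (x ^+ n).
Proof.
move=> Ix; elim: n => [|n IHn]; first by rewrite expr0.
by rewrite exprS; apply: filtMl.
Qed.

Definition principal x := I 1 (x - 1).

Lemma principal_neq0 x : principal x -> x != 0.
Proof. by move=> /Iinv[]; rewrite addrC subrK. Qed.

Lemma principal_inv0 x : principal x -> I 0 x^-1.
Proof. by move=> /Iinv[_]; rewrite [1 + _]addrC subrK. Qed.

Lemma principal_filt0 x : principal x -> I 0 x.
Proof. by move=> /IS H; rewrite -(subrK 1 x); apply: filtD. Qed.

Lemma filt_exprz x (E : int) : principal x -> I 0 (x ^ E).
Proof.
move=> Px; case: E => n; first exact: filt0X (principal_filt0 Px).
by rewrite NegzE -exprz_inv; apply: filt0X (principal_inv0 Px).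
Qed.

Definition binomz_sum (D : nat) (E : int) (z : K) := \sum_(0 <= m < D) inj (binomz E m) * z ^+ m.

Lemma binomz_sum_step D E z :
  (1 + z) * binomz_sum D.+1 E z = binomz_sum D.+1 (E + 1) z + inj (binomz E D) * z ^+ D.+1.
Proof.
rewrite /binomz_sum; elim: D => [|D IHD].
  by rewrite !big_nat1 !binomz0 rmorph1 expr0 expr1; ring.
rewrite !(big_nat_recr D.+1) //= mulrDr IHD binomz_Pascal rmorphD [z ^+ D.+2]exprS; ring.
Qed.

Lemma binomz_sum0 D z : binomz_sum D.+1 0 z = 1.
Proof.
rewrite /binomz_sum big_nat_recl // binomz0 rmorph1 expr0 mulr1 big1 ?addr0 // => m _.
by rewrite /binomz big_ord_recl subrr !mul0r rmorph0 mul0r.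
Qed.

(** Multiplication by the unit [1 + z] relates the claim for [E] to the claim for
[E + 1], with an error of order [D] coming from the truncation.  Since the claim is
trivial for [E = 0], it propagates to all integers, upwards and downwards. *)
Lemma binomial_series D E z : I 1 z -> I D ((1 + z) ^ E - binomz_sum D E z).
Proof.
case: D => [|D] Iz.
  rewrite /binomz_sum big_nil subr0; apply: filt_exprz.
  by rewrite /principal addrAC subrr add0r.
have Pz : principal (1 + z) by rewrite /principal addrAC subrr add0r.
have z0 := principal_neq0 Pz.
have R F : (1 + z) * ((1 + z) ^ F - binomz_sum D.+1 F z)
  = ((1 + z) ^ (F + 1) - binomz_sum D.+1 (F + 1) z) - inj (binomz F D) * z ^+ D.+1.
  rewrite mulrBr binomz_sum_step expfzDr // expr1z; ring.
have T F : I D.+1 (inj (binomz F D) * z ^+ D.+1) by apply: filtMl => //; apply: filtX.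
elim/int_ind: E => [|n IH|n IH].
- by rewrite binomz_sum0 expr0z subrr.
- have -> : n.+1%:Z = n%:Z + 1 by lia.
  move: (filtMl (principal_filt0 Pz) IH); rewrite R => H.
  by rewrite -[X in I _ X](subrK (inj (binomz n D) * z ^+ D.+1)); apply: filtD.
have := IH; have -> : - n%:Z = - n.+1%:Z + 1 by lia.
move=> {}IH; rewrite -[X in I _ X](mulKf z0) R.
by apply: filtMl (principal_inv0 Pz) _; apply: IB.
Qed.
End Filtration.

(** * Expansion along the exchange relations *)

(** The sorted words with letters in [x, x + k) and fewer than [N] occurrences of
each letter, listed in the order in which the expansion produces them. *)
Fixpoint words (N x k : nat) : seq (seq nat) :=
  if k is k'.+1 then [seq nseq m x ++ w | m <- iota 0 N, w <- words N x.+1 k'] else [:: [::]].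

Lemma words_ge N x k w : w \in words N x k -> all (leq x) w.
Proof.
elim: k x w => [|k IHk] x w /=; first by rewrite inE => /eqP->.
case/allpairsP => -[m w'] /= [_ /IHk w'x ->].
rewrite all_cat all_nseq leqnn orbT /=.
by apply: sub_all w'x => y; apply: ltnW.
Qed.

Lemma words_sorted N x k w : w \in words N x k -> sorted leq w.
Proof.
elim: k x w => [|k IHk] x w /=; first by rewrite inE => /eqP->.
case/allpairsP => -[m w'] /= [_ H ->].
have w's := IHk _ _ H; have w'x := words_ge H.
elim: m => //= m; case: m => [|m] /=; last by rewrite leqnn.
by move=> _; rewrite path_min_sorted //; apply: sub_all w'x => y; apply: ltnW.
Qed.

Lemma words_lt N x k w : w \in words N x k -> all (fun y => y < x + k)%N w.
Proof.
elim: k x w => [|k IHk] x w /=; first by rewrite inE => /eqP->.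
case/allpairsP => -[m w'] /= [_ /IHk w'x ->].
rewrite all_cat all_nseq addnS ltnS leq_addr orbT /=.
by apply: sub_all w'x => y; rewrite addSn.
Qed.

Lemma words_uniq N x k : uniq (words N x k).
Proof.
elim: k x => [|k IHk] x //=.
apply: allpairs_uniq => //; first exact: iota_uniq.
move=> [m1 w1] [m2 w2] /allpairsP[[n1 v1] /= [_ H1 [-> ->]]] /allpairsP[[n2 v2] /= [_ H2 [-> ->]]] E.
have cnt m w : w \in words N x.+1 k -> count_mem x (nseq m x ++ w) = m.
  move=> /words_ge/allP wx; rewrite count_cat count_nseq /= eqxx mul1n.
  by rewrite (count_memPn _) ?addn0 //; apply/negP => /wx; rewrite ltnn.
have Em := congr1 (count_mem x) E; rewrite !cnt // in Em.
rewrite -Em in E *; congr (_, _).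
by have := congr1 (drop (size (nseq n1 x))) E; rewrite !drop_size_cat.
Qed.

Lemma mem_words N x k w : (size w < N)%N -> sorted leq w -> all (leq x) w ->
  all (fun y => y < x + k)%N w -> w \in words N x k.
Proof.
elim: k x w => [|k IHk] x w wN ws wx wk.
  case: w wx wk {wN ws} => // y w /= /andP[xy _]; rewrite addn0 => /andP[].
  by rewrite ltnNge xy.
have [m [w' [wEq w'x]]] : exists m w', w = nseq m x ++ w' /\ all (leq x.+1) w'.
  elim: w ws wx {wN wk} => [_ _|y w IHw]; first by exists 0%N, [::].
  rewrite [sorted _ _]/= => yw /= /andP[xy wx].
  have [m [w' [wEq w'x]]] := IHw (path_sorted yw) wx.
  have [->|yx] := eqVneq y x; first by exists m.+1, w'; rewrite wEq.
  exists 0%N, (y :: w); split=> //=.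
  have xy' : (x < y)%N by rewrite ltn_neqAle eq_sym yx.
  rewrite xy' /=; apply/allP => z zw.
  by move: yw; rewrite path_sortedE; [case/andP=> /allP/(_ _ zw)|exact: leq_trans] => /(leq_trans xy').
rewrite /=; apply/allpairsP; exists (m, w') => /=; split=> //.
  by rewrite mem_iota /= add0n; move: wN; rewrite wEq size_cat size_nseq; lia.
apply: IHk => //.
- by move: wN; rewrite wEq size_cat; lia.
- by move: ws; rewrite wEq; apply: (subseq_sorted leq_trans); apply: suffix_subseq.
- by move: wk; rewrite wEq all_cat => /andP[_]; apply: sub_all => z; rewrite addSnnS.
Qed.

Section Weights.
Variable r : nat.

(** The amount by which one letter [y] lowers the exponent attached to the letter
[x], when [d = x - y]. *)
Definition gap (d : int) : int := s_seq r d + s_seq r (d - 2).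

(** If the letters of [p], all below [x], have been processed, what remains to be
expanded is [F_k ^ lead_exp p x * F_(k-1) ^ trail_exp p x] for some [k]. *)
Definition lead_exp (p : seq nat) (x : nat) : int := s_seq r x - \sum_(y <- p) gap (x%:Z - y%:Z).

Definition trail_exp (p : seq nat) (x : nat) : int := lead_exp p x.+1 - r%:Z * lead_exp p x.

Lemma lead_exp_cat p q x : lead_exp (p ++ q) x = lead_exp p x - \sum_(y <- q) gap (x%:Z - y%:Z).
Proof. by rewrite /lead_exp big_cat opprD addrA. Qed.

(** This fails for [d = 0], where [gap 0 = 1] while the recursion would ask for the
value [0]; the lemmas on exponents therefore require letters below [x]. *)
Lemma gap_rec (d : int) : 0 < d -> gap (d + 2) = r%:Z * gap (d + 1) - gap d.
Proof.
move=> d0; rewrite /gap (s_seq_rec r (k := d)); last by lia.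
have -> : d + 2 - 2 = (d - 2) + 2 by lia.
have -> : d + 1 - 2 = (d - 2) + 1 by lia.
rewrite (s_seq_rec r (k := d - 2)); last by lia.
by ring.
Qed.

Lemma gap0 : gap 0 = 1. Proof. by []. Qed.
Lemma gap1 : gap 1 = r%:Z. Proof. by rewrite /gap /= addr0. Qed.
Lemma gap2 : gap 2 = r%:Z * r%:Z. Proof. by rewrite /gap /= subrK. Qed.

Lemma lead_exp_rec p x : all (fun y => y < x)%N p ->
  lead_exp p x.+2 = r%:Z * lead_exp p x.+1 - lead_exp p x.
Proof.
move=> px; rewrite /lead_exp.
have -> : x.+2%:Z = x%:Z + 2 by lia.
have -> : x.+1%:Z = x%:Z + 1 by lia.
rewrite s_seq_rec; last by lia.
have -> : \sum_(y <- p) gap (x%:Z + 2 - y%:Z) = \sum_(y <- p)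
   (r%:Z * gap (x%:Z + 1 - y%:Z) - gap (x%:Z - y%:Z)).
  apply: eq_big_seq => y /(allP px) yx.
  rewrite -addrAC gap_rec; last by lia.
  by rewrite addrAC.
rewrite sumrB -mulr_sumr; ring.
Qed.

(** This lemma and the next one match the exponents [r (E - m) + D] and [- E] which
the binomial series produces. *)
Lemma lead_exp_next p x m : lead_exp (p ++ nseq m x) x.+1 = r%:Z * (lead_exp p x - m%:Z) + trail_exp p x.
Proof.
rewrite lead_exp_cat big_nseq iter_addr_0 /trail_exp; have -> : x.+1%:Z - x%:Z = 1 by lia.
by rewrite gap1 -mulr_natr natz; ring.
Qed.

Lemma trail_exp_next p x m : all (fun y => y < x)%N p -> trail_exp (p ++ nseq m x) x.+1 = - lead_exp p x.
Proof.
move=> px; rewrite {1}/trail_exp lead_exp_next lead_exp_cat big_nseq iter_addr_0 lead_exp_rec //.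
have -> : x.+2%:Z - x%:Z = 2 by lia.
by rewrite gap2 /trail_exp -mulr_natr natz; ring.
Qed.

Fixpoint lead_prod (p w : seq nat) : rat :=
  if w is x :: w' then (lead_exp p x)%:~R * lead_prod (rcons p x) w' else 1.

Definition mult_fact (w : seq nat) : nat := \prod_(x <- undup w) (count_mem x w)`!.

Definition word_coef (p w : seq nat) : rat := lead_prod p w / (mult_fact w)%:R.

(** Since [gap 0 = 1], each further copy of [x] lowers the exponent by one, and the
product over a block of equal letters is a falling factorial. *)
Lemma lead_prod_nseq p x m w :
  lead_prod p (nseq m x ++ w) =
  \prod_(l < m) (lead_exp p x - l%:Z)%:~R * lead_prod (p ++ nseq m x) w.
Proof.
elim: m p => [|m IHm] p /=; first by rewrite big_ord0 mul1r cats0.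
rewrite IHm big_ord_recl subr0 cat_rcons mulrA; congr (_ * _ * _).
apply: eq_bigr => i _; congr (_%:~R).
by rewrite -cats1 lead_exp_cat big_seq1 subrr gap0 lift0; lia.
Qed.

Lemma mult_fact_nseq x m w : x \notin w -> mult_fact (nseq m x ++ w) = (m`! * mult_fact w)%N.
Proof.
move=> xw; case: m => [|m]; first by rewrite mul1n.
have uE : undup (nseq m.+1 x ++ w) = x :: undup w :> seq nat.
  by elim: m => [|m IHm] /=; [rewrite (negbTE xw)|rewrite inE eqxx -IHm].
rewrite /mult_fact uE big_cons; congr (_`! * _)%N.
  by rewrite count_cat count_nseq /= eqxx mul1n (count_memPn xw) addn0.
apply: eq_big_seq => y; rewrite mem_undup => yw; congr (_`!).
rewrite count_cat count_nseq /=; case: eqP => [xy|]; last by rewrite mul0n.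
by rewrite xy yw in xw.
Qed.

Lemma word_coef_nseq p x m w : x \notin w ->
  word_coef p (nseq m x ++ w) = binomz (lead_exp p x) m * word_coef (p ++ nseq m x) w.
Proof.
move=> xw; rewrite /word_coef /binomz lead_prod_nseq mult_fact_nseq // natrM invfM; ring.
Qed.

Section Expansion.
Variables (K : fieldType) (I : nat -> K -> Prop) (inj : {rmorphism rat -> K}).
Variable FI : adic_filtration I inj.
Let I0 := adic_0 FI.
Let Iinj := adic_scalar FI.
Let IS := adic_weaken FI.

Variables (f Y : nat -> K).
Hypothesis f0 : f 0%N = 1.
Hypothesis f1 : f 1%N = 1.
Hypothesis fP : forall t, principal I (f t).
Hypothesis YP : forall t, I 1 (Y t).
Hypothesis frec : forall t, f t.+2 * f t = Y t + f t.+1 ^+ r.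

(** The lower index decreases by one at each step, so the letter [z] is paired with
[Y (k + x - z.+1)], where [k + x] stays constant.  With
[z = Y k / f k.+1 ^ r], which has positive order, [f k.+2] is
[(1 + z) * f k.+1 ^ r / f k], and the induction step is the binomial series in
[z]. *)
Lemma exchange_expansion N k x p : all (fun y => y < x)%N p ->
  I N (f k.+1 ^ lead_exp p x * f k ^ trail_exp p x
       - \sum_(w <- words N x k) inj (word_coef p w) * \prod_(z <- w) Y (k + x - z.+1)%N).
Proof.
elim: k x p => [|k IHk] x p px.
  rewrite f0 f1 !exp1rz mul1r /= big_seq1 /word_coef /mult_fact /= !big_nil divr1 rmorph1 mul1r subrr.
  exact: I0.
have fn0 t : f t != 0 := principal_neq0 FI (fP t).
set E := lead_exp p x; set D := trail_exp p x.
pose z := Y k / f k.+1 ^+ r.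
have Iz : I 1 z.
  by apply: (filtMr FI) => //; rewrite exprnN; apply: (filt_exprz FI).
have f2E : f k.+2 = (1 + z) * (f k.+1 ^+ r / f k).
  apply: (mulIf (fn0 k)); rewrite frec /z; field.
  by rewrite fn0 expf_neq0.
pose C := (f k.+1 ^+ r / f k) ^ E * f k.+1 ^ D.
have CE : C = f k.+1 ^ (r%:Z * E + D) * f k ^ (- E).
  by rewrite /C expfzMl exprz_inv exprnP exprz_exp mulrAC -expfzDr.
have IC : I 0 C by rewrite CE; apply: (filtMl FI) => //; apply: (filt_exprz FI).
pose G m := f k.+1 ^ lead_exp (p ++ nseq m x) x.+1 * f k ^ trail_exp (p ++ nseq m x) x.+1.
have zG m : z ^+ m * C = Y k ^+ m * G m.
  rewrite /G CE /z lead_exp_next trail_exp_next // -/E -/D expr_div_n -mulrA; congr (_ * _).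
  rewrite mulrA; congr (_ * _).
  rewrite -exprM exprnN -expfzDr //; congr (_ ^ _).
  by rewrite PoszM; ring.
have -> : f k.+2 ^ E * f k.+1 ^ D = (1 + z) ^ E * C.
  by rewrite f2E expfzMl // mulrA.
have SE : binomz_sum inj N E z * C = \sum_(m <- iota 0 N) inj (binomz E m) * Y k ^+ m * G m.
  rewrite /binomz_sum mulr_suml /index_iota subn0; apply: eq_bigr => m _.
  by rewrite -!mulrA zG.
have -> (a b : K) : a - b = a - binomz_sum inj N E z * C + (binomz_sum inj N E z * C - b) by rewrite addrA subrK.
apply: (filtD FI) => //.
  by rewrite -mulrBl; apply: (filtMr FI) => //; apply: (binomial_series FI).
rewrite SE big_allpairs_dep /= -sumrB; apply: (filt_sum FI) => // m _.
set S := (X in I N (_ - X)).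
have -> : S = inj (binomz E m) * Y k ^+ m * \sum_(w <- words N x.+1 k)
   inj (word_coef (p ++ nseq m x) w) * \prod_(t <- w) Y (k + x.+1 - t.+1)%N.
  rewrite mulr_sumr; apply: eq_big_seq => w wk.
  have xw : x \notin w by apply/negP => /(allP (words_ge wk)); rewrite ltnn.
  rewrite word_coef_nseq // rmorphM big_cat /=.
  rewrite big_nseq iter_mulr_1.
  have -> : (k.+1 + x - x.+1)%N = k by lia.
  by rewrite addSnnS; ring.
rewrite -mulrBr; apply: (filtMl FI) => //.
  by apply: (filtMl FI) => //; apply: (filt0X FI) => //; apply: IS.
apply: IHk.
rewrite all_cat all_nseq ltnSn orbT andbT.
by apply: sub_all px => y; apply: ltnW.
Qed.
End Expansion.
End Weights.

(** * The coefficient of a word *)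

Lemma mult_fact_rem x w : x \in w -> mult_fact w = (count_mem x w * mult_fact (rem x w))%N.
Proof.
move=> xw; rewrite /mult_fact.
have side s : (forall y, y \in s -> y \in w) ->
   (\prod_(y <- undup s) (count_mem y s)`! = \prod_(y <- undup w) (count_mem y s)`!)%N.
  move=> sw; rewrite [RHS](bigID (mem s)) /= [X in (_ * X)%N]big1 ?muln1; last first.
    by move=> y /count_memPn ->.
  rewrite -[RHS]big_filter; apply: perm_big; apply: uniq_perm; rewrite ?filter_uniq ?undup_uniq //.
  move=> y; rewrite mem_filter !mem_undup /=; case ys: (y \in s) => //=.
  by rewrite sw.
rewrite (side (rem x w)); last by move=> y; apply: mem_rem.
have xu : x \in undup w by rewrite mem_undup.
rewrite !(bigD1_seq x) ?undup_uniq //= mulnA; congr (_ * _)%N.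
  rewrite count_mem_rem eqxx; move: xw; rewrite -has_pred1 has_count.
  by case: (count_mem x w) => // n _; rewrite subn1 factS.
by apply: eq_bigr => y yx; rewrite count_mem_rem eq_sym (negbTE yx) subn0.
Qed.

(** The multinomial count of the rearrangements, by induction on their first
letter. *)
Lemma size_permutations_mult_fact w : (size (permutations w) * mult_fact w = (size w)`!)%N.
Proof.
have [n] := ubnP (size w); elim: n w => // n IHn w wn.
have [w0|w0] := posnP (size w).
  by rewrite (size0nil w0) /mult_fact /= big_nil.
rewrite (perm_size (permutationsE w0)) size_allpairs_dep sumnE big_map big_distrl /=.
have -> : (size w)`! = (\sum_(x <- undup w) count_mem x w * (size w).-1`!)%N.
  rewrite -big_distrl /= -{1}(prednK w0) factS prednK //; congr (_ * _)%N.
  rewrite -{1}(perm_size (perm_count_undup w)) size_flatten sumnE !big_map.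
  by apply: eq_bigr => x _; rewrite size_nseq.
apply: eq_big_seq => x; rewrite mem_undup => xw.
rewrite (mult_fact_rem xw) mulnCA IHn size_rem //.
by move: wn w0; lia.
Qed.

Section Coef.
Variable r : nat.

Lemma lead_prodE p w : lead_prod r p w =
  \prod_(i < size w) (lead_exp r (p ++ take i w) (nth 0%N w i))%:~R.
Proof.
elim: w p => [|x w IHw] p; first by rewrite big_ord0.
rewrite big_ord_recl /= cats0 IHw; congr (_ * _).
by apply: eq_bigr => i _; rewrite cat_rcons.
Qed.

(** In this form the [1 / k!] of [phi] has been traded for the denominators
[m_v!] of the binomial coefficients. *)
Lemma term_coefE w : term_coef r w = word_coef r [::] w.
Proof.
rewrite /term_coef /word_coef lead_prodE mulrC; congr (_ * _).
  apply: eq_bigr => i _; rewrite /lead_exp /=; congr ((_ - _)%:~R).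
  rewrite (big_nth 0%N) size_takel ?(ltnW (ltn_ord i)) // big_mkord.
  by apply: eq_bigr => j _; rewrite nth_take.
rewrite /phi -size_permutations_mult_fact natrM invfM mulrA divff ?mul1r //.
rewrite pnatr_eq0 -lt0n; have := size_permutations_mult_fact w.
by case: (size (permutations w)) => // /esym/eqP; rewrite mul0n; move: (fact_gt0 (size w)); case: (_`!).
Qed.
End Coef.

(** * Coefficients of the F-polynomials *)

Section Coefficients.
Variable r : nat.
Hypothesis hr : (2 <= r)%N.
Local Notation u := (chebyshev r).
Local Notation K := (label_field 2).
Local Notation A := {mpoly rat[2]}.
Local Notation X := ('X_vertex1 : A).

(** The powers of the ideal of [y_1] in the localization of the polynomial ring at
[1 + y_1 A]. *)
Definition X_filt (D : nat) (x : K) : Prop :=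
  exists P Q : A, one_mod_X Q /\ x * tofrac Q = tofrac (X ^+ D * P).

Definition scalar_frac : {rmorphism rat -> K} := (@tofrac A \o @mpolyC 2 rat : {rmorphism _ -> _}).

Lemma X_filt_frac D P : X_filt D (tofrac (X ^+ D * P)).
Proof. by exists P, 1; split; [apply: one_mod_X1|rewrite tofrac1 mulr1]. Qed.

Lemma X_filt_tofrac P : X_filt 0 (tofrac P).
Proof. by have := X_filt_frac 0 P; rewrite expr0 mul1r. Qed.

Lemma X_filt0 D : X_filt D 0.
Proof. by have := X_filt_frac D 0; rewrite mulr0 tofrac0. Qed.

Lemma X_filt1 : X_filt 0 1.
Proof. by have := X_filt_tofrac 1; rewrite tofrac1. Qed.

Lemma X_filtB D x y : X_filt D x -> X_filt D y -> X_filt D (x - y).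
Proof.
move=> [P [Q [QX xE]]] [P' [Q' [QX' yE]]].
exists (P * Q' - P' * Q), (Q * Q'); split; first exact: one_mod_XM.
rewrite tofracM mulrBl mulrA xE [tofrac Q * _]mulrC mulrA yE -!tofracM -tofracB.
by congr tofrac; ring.
Qed.

Lemma X_filtM D D' x y : X_filt D x -> X_filt D' y -> X_filt (D + D') (x * y).
Proof.
move=> [P [Q [QX xE]]] [P' [Q' [QX' yE]]].
exists (P * P'), (Q * Q'); split; first exact: one_mod_XM.
by rewrite tofracM mulrACA xE yE -tofracM exprD; congr tofrac; ring.
Qed.

Lemma X_filt_inv x : X_filt 1 x -> 1 + x != 0 /\ X_filt 0 (1 + x)^-1.
Proof.
move=> [P [Q [QX xE]]].
have QX' : one_mod_X (Q + X * P) by apply: one_mod_XD.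
have E : (1 + x) * tofrac Q = tofrac (Q + X * P).
  by rewrite mulrDl mul1r xE expr1 tofracD.
have x0 : 1 + x != 0.
  apply/eqP => x0; move/eqP: E.
  by rewrite x0 mul0r eq_sym tofrac_eq0 (negbTE (one_mod_X_neq0 QX')).
split=> //; exists Q, (Q + X * P); split=> //.
by rewrite -E mulKf // expr0 mul1r.
Qed.

Lemma X_filtS D x : X_filt D.+1 x -> X_filt D x.
Proof.
by move=> [P [Q [QX xE]]]; exists (X * P), Q; split=> //; rewrite xE exprSr mulrA.
Qed.

Lemma X_filt_adic : adic_filtration X_filt scalar_frac.
Proof.
split.
- exact: X_filt0.
- exact: X_filt1.
- by move=> c; apply: X_filt_tofrac.
- exact: X_filtB.
- exact: X_filtM.
- exact: X_filtS.
exact: X_filt_inv.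
Qed.

(** Clearing the denominator [1 + y_1 H] turns the hypothesis into
[P = y_1 ^ D G - y_1 H P]; substituting this into itself extracts one more factor
[y_1] each time, until [y_1 ^ D] is reached. *)
Lemma X_filt_coef D (P : A) (m : 'X_{1..2}) : X_filt D (tofrac P) -> (m vertex1 < D)%N -> P@_m = 0.
Proof.
move=> [G [Q [[H ->]]]] /eqP; rewrite -tofracM tofrac_eq => /eqP E mD.
suff [R ->] : exists R, P = 'X_[(U_(vertex1) *+ D)%MM] * R.
  apply: mcoeffMX0; apply/negP => /mnm_lepP/(_ vertex1).
  by rewrite mulmnE mnm1E eqxx mul1n leqNgt mD.
suff [R ->] : exists R, P = X ^+ D * R by exists R; rewrite -mpolyXn.
suff H' k : (k <= D)%N -> exists R, P = X ^+ k * R by exact: H'.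
elim: k => [|k IHk] kD; first by exists P; rewrite expr0 mul1r.
have [R PE] := IHk (ltnW kD).
exists (X ^+ (D - k.+1) * G - H * R).
have -> : P = P * (1 + X * H) - X * (H * P) by ring.
rewrite E {1}PE -{1}(subnKC kD) exprD exprS; ring.
Qed.

Definition word_exp (T : nat) (w : seq nat) : 'X_{1..2} :=
  (\sum_(z <- w) c_exp r (T - z.+1))%MM.

(** The truncation at [N] is harmless: both sides are polynomials, and their
difference has order at least [N] in [y_1]. *)
Lemma F_poly_coef T N (m : 'X_{1..2}) : (m vertex1 < N)%N ->
  (F_poly (kronecker r) alternating T)@_m =
  \sum_(w <- words N 0 T | word_exp T w == m) term_coef r w.
Proof.
move=> mN; pose P : A := \sum_(w <- words N 0 T) term_coef r w *: 'X_[word_exp T w].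
suff /X_filt_coef/(_ mN)/eqP : X_filt N (tofrac (F_poly (kronecker r) alternating T - P)).
  rewrite mcoeffB subr_eq0 => /eqP ->; rewrite /P raddf_sum /= [RHS]big_mkcond /=.
  by apply: eq_bigr => w _; rewrite mcoeffZ mcoeffX; case: eqP; rewrite ?mulr1 ?mulr0.
have fP t : principal X_filt (F_label r t).
  have [Q [[G ->] <-]] := F_spec_ex hr t.
  rewrite /principal tofracD tofrac1 addrAC subrr add0r.
  by have := X_filt_frac 1 G; rewrite expr1.
have YP t : X_filt 1 (tofrac (c_mon r t)).
  by have [G ->] := c_mon_dvdX hr t; have := X_filt_frac 1 G; rewrite expr1.
have frec t : F_label r t.+2 * F_label r t = tofrac (c_mon r t) + F_label r t.+1 ^+ r.
  by rewrite F_labelSS mulfVK //; apply: (principal_neq0 X_filt_adic).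
have := @exchange_expansion r K X_filt scalar_frac X_filt_adic
  (F_label r) (fun t => tofrac (c_mon r t)) erefl erefl fP YP frec N T 0 [::] isT.
have -> : lead_exp r [::] 0 = 1 by rewrite /lead_exp big_nil.
have -> : trail_exp r [::] 0 = 0 by rewrite /trail_exp /lead_exp !big_nil /= !subr0 mulr1 subrr.
rewrite expr1z expr0z mulr1 -(F_poly_spec hr T).2 tofracB /P.
rewrite (rmorph_sum (@tofrac A)) /=.
set S := \sum_(w <- _) _ ; set S' := \sum_(w <- _) _; suff -> : S = S' by [].
apply: eq_bigr => w _; rewrite -term_coefE -mul_mpolyC tofracM; congr (_ * _).
rewrite /word_exp; elim: w => [|z w IHw]; first by rewrite !big_nil mpolyX0 tofrac1.
by rewrite !big_cons mpolyXD tofracM IHw addn0.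
Qed.
End Coefficients.

(** * The deformed F-polynomials *)

Section Deformed.
Variable r : nat.
Hypothesis hr : (2 <= r)%N.
Local Notation u := (chebyshev r).
Local Notation C T := (C_matrix (kronecker r) alternating T).

(** The exchange of variables needed when the last mutation was at vertex 2. *)
Definition parity_perm (T : nat) : 'S_2 := if odd T then 1%g else tperm vertex1 vertex2.

Lemma parity_permK T : involutive (row_perm (parity_perm T) : 'cV[int]_2 -> 'cV[int]_2).
Proof.
move=> v; apply/matrixP => i j; rewrite !mxE /parity_perm.
by case: odd; rewrite ?perm1 ?tpermK.
Qed.

Lemma parity_perm_last T : parity_perm T (alternating T) = vertex1.
Proof. by rewrite /parity_perm /alternating; case: odd; rewrite ?perm1 ?tpermR. Qed.

Lemma parity_perm_next T : parity_perm T (alternating T.+1) = vertex2.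
Proof. by rewrite /parity_perm /alternating /=; case: odd; rewrite ?perm1 ?tpermL. Qed.

Lemma C_matrix_mul T (v : 'cV[int]_2) i :
  (C T.+1 *m v) i 0 = (c_exp r T.+1 i)%:Z * v (alternating T.+2) 0
                    - (c_exp r T i)%:Z * v (alternating T.+1) 0.
Proof.
rewrite mxE (bigD1 (alternating T.+2)) //= (bigD1 (alternating T.+1)) /=; last first.
  by rewrite eq_sym alternating_neq.
rewrite big1 ?addr0 => [|j /andP[]]; last first.
  by move: j; apply: (alternating_ind (t := T.+1)) => /=; rewrite eqxx.
by rewrite C_matrix_last // mulNr alternatingSS C_matrix_next.
Qed.

Lemma C_matrix_unit T : C T.+1 \in unitmx.
Proof.
pose B : 'M[int]_2 := \matrix_(i, j)
  let k := if i == alternating T.+2 then T else T.+1 in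
  if j == vertex1 then - (u k)%:Z else (u k.+1)%:Z.
suff : C T.+1 *m B = 1%:M by case/mulmx1_unit.
have := chebyshev_det hr (leqnSn T); rewrite subSnn /= => D.
apply/matrixP => i j.
have -> : (C T.+1 *m B) i j = (C T.+1 *m col j B) i 0.
  by rewrite !mxE; apply: eq_bigr => k _; rewrite [col j B k 0]mxE.
rewrite C_matrix_mul !mxE.
rewrite eqxx [alternating T.+1 == _]eq_sym (negbTE (alternating_neq T.+1)) !mnmE.
move: D; case: j => -[|[|//]] ?; case: i => -[|[|//]] ?; rewrite /= -!chebyshevSS; nia.
Qed.

Lemma exponentE w : exponent r w =
  monomial2 (\sum_(z <- w) (u z.+1)%:Z) (\sum_(z <- w) (u z)%:Z).
Proof.
by rewrite /exponent; congr monomial2; apply: eq_bigr => z _;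
  rewrite ?s_seqE ?s_seq_pred.
Qed.

Lemma c_exp_rotate T z i : (z <= T)%N ->
  (c_exp r (T - z) i)%:Z = (c_exp r T i)%:Z * (u z.+1)%:Z - (c_exp r T.+1 i)%:Z * (u z)%:Z.
Proof.
move=> zT; rewrite !mnmE; case: ifP => _; last by rewrite chebyshev_det.
by rewrite -subSn // chebyshev_det // leqW.
Qed.

(** The matrix [- C_t ^ (-1)] maps [c_(t-1-z)] to [(u_(z+1), u_z)], up to the order of
the coordinates; this is [chebyshev_det], one letter at a time. *)
Lemma word_expE T w : all (fun z => z < T.+1)%N w ->
  (\col_i (word_exp r T.+1 w i)%:Z) = - (C T.+1 *m row_perm (parity_perm T.+1) (exponent r w)).
Proof.
move=> wT; apply/colP => i; rewrite mxE [RHS]mxE C_matrix_mul exponentE !mxE.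
rewrite parity_perm_last parity_perm_next /=.
rewrite !mulr_sumr -sumrB -sumrN /word_exp mnm_sumE.
rewrite (big_morph Posz PoszD (erefl 0%:Z)).
apply: eq_big_seq => z /(allP wT) zT.
by rewrite subSS c_exp_rotate // opprB.
Qed.

(** The matrix being invertible, the coefficient of the deformed polynomial at [v]
is the coefficient of the F-polynomial at [- C v], if this vector has nonnegative
entries; otherwise neither side has any term. *)
Lemma deformed_FE T (N : nat) (v : 'cV[int]_2) :
  (`|((C T.+1 *m v) vertex1 0)%R| < N)%N ->
  deformed_F (kronecker r) alternating T.+1 v =
  \sum_(w <- words N 0 T.+1 | exponent r w == row_perm (parity_perm T.+1) v) term_coef r w.
Proof.
move=> vN; rewrite /deformed_F /mx_act.
have CK := mulKmx (C_matrix_unit T).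
have CK' := mulKVmx (C_matrix_unit T).
have E (c : 'cV[int]_2) : (- invmx (C T.+1) *m c == v) = (c == - (C T.+1 *m v)).
  rewrite mulNmx; apply/eqP/eqP => [<-|->]; first by rewrite mulmxN CK' opprK.
  by rewrite mulmxN opprK CK.
have E2 w : w \in words N 0 T.+1 ->
   (exponent r w == row_perm (parity_perm T.+1) v) = ((\col_i (word_exp r T.+1 w i)%:Z) == - (C T.+1 *m v)).
  move=> /words_lt; rewrite add0n => wT; rewrite word_expE // eqr_opp.
  rewrite (can_eq (CK 1%N)).
  by rewrite -(inj_eq (can_inj (parity_permK T.+1))) parity_permK.
under eq_bigl do rewrite E.
rewrite [RHS]big_seq_cond.
under [RHS]eq_bigl => w do rewrite (andb_id2l (@E2 w)).
rewrite -big_seq_cond.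
have [[m mE]|no] := pselect (exists m : 'X_{1..2}, (\col_i (m i)%:Z) = - (C T.+1 *m v)); last first.
  by rewrite !big1 // => m /eqP mE; case: no; eexists; exact: mE.
have col_inj (m' : 'X_{1..2}) : (\col_i (m' i)%:Z == - (C T.+1 *m v)) = (m' == m).
  rewrite -mE; apply/eqP/eqP => [/colP H|->//].
  by apply/mnmP => i; have := H i; rewrite !mxE => -[].
under eq_bigl do rewrite col_inj.
under [RHS]eq_bigl do rewrite col_inj.
rewrite -F_poly_coef //; last first.
  by have /colP/(_ vertex1) := mE; rewrite !mxE; move: vN; rewrite !mxE; lia.
set P := F_poly _ _ _; case mP : (m \in msupp P).
  by rewrite -big_filter (eq_filter (a2 := pred1 m)) // filter_pred1_uniq ?msupp_uniq // big_seq1.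
rewrite memN_msupp_eq0 ?mP // big_seq_cond big1 // => m' /andP[mP' /eqP mm].
by rewrite -mm mP' in mP.
Qed.
End Deformed.

(** * Degree in the first variable *)

Section Degree.
Variable r : nat.
Hypothesis hr : (2 <= r)%N.
Local Notation u := (chebyshev r).
Local Notation A := {mpoly rat[2]}.

(** Polynomials in [y_1] over polynomials in [y_2]: here sizes of products add up,
which gives access to the degree in the first variable alone. *)
Definition two_vars (i : 'I_2) : {poly {poly rat}} := if i == vertex1 then 'X else 'X%:P.

Definition to_poly2 : {rmorphism A -> {poly {poly rat}}} :=
  mmap (polyC \o polyC) two_vars.

Lemma to_poly2X m : to_poly2 'X_[m] = 'X^(m vertex1) * ('X^(m vertex2))%:P.
Proof.
rewrite /to_poly2 /= mmapX /mmap1 !big_ord_recl big_ord0 mulr1 /two_vars /=.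
rewrite rmorphXn /=; congr ('X^(m _) * 'X%:P ^+ m _); exact: val_inj.
Qed.

Lemma to_poly2_coef P (m : 'X_{1..2}) : (to_poly2 P)`_(m vertex1)`_(m vertex2) = P@_m.
Proof.
rewrite [in LHS](mpolyE P) raddf_sum /= !coef_sum [in RHS](mpolyE P) raddf_sum /=.
apply: eq_bigr => k _; rewrite -mul_mpolyC rmorphM /= to_poly2X mcoeffCM mcoeffX.
rewrite [to_poly2 _]mmapC /= coefCM coefMC coefXn coefCM; congr (_ * _).
have -> : (k == m) = (m vertex1 == k vertex1) && (m vertex2 == k vertex2).
  apply/eqP/andP => [->//|[/eqP E1 /eqP E2]].
  by apply/mnmP; apply: (alternating_ind (t := 0)).
case: eqP => _; rewrite ?mul1r ?coefXn // mul0r; exact: coef0.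
Qed.

Lemma to_poly2_size P (m : 'X_{1..2}) : P@_m != 0 -> (m vertex1 < size (to_poly2 P))%N.
Proof.
rewrite -to_poly2_coef; apply: contraR; rewrite -leqNgt => H.
by rewrite (nth_default _ H); apply/eqP; exact: coef0.
Qed.

Lemma size_c_mon t : size (to_poly2 (c_mon r t)) = (u t.+1).+1.
Proof.
rewrite to_poly2X !mnmE /= mulrC mul_polyC size_scale ?size_polyXn //.
by rewrite expf_neq0 // polyX_eq0.
Qed.

(** Compare degrees in [y_1] in the exchange relation [Q * P0 = c_mon t.+1 + P ^ r]:
the power has degree [r u_(t+1) = u_(t+2) + u_t], the monomial only [u_(t+2)]. *)
Lemma F_spec_size t P : F_spec r t.+1 P -> size (to_poly2 P) = (u t).+1.
Proof.
suff H : forall t P Q, F_spec r t.+1 P -> F_spec r t.+2 Q ->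
    size (to_poly2 P) = (u t).+1 /\ size (to_poly2 Q) = (u t.+1).+1.
  move=> SP; have [Q SQ] := F_spec_ex hr t.+2; exact: (H t P Q SP SQ).1.
have F_spec1 P' t' : t' = 0%N \/ t' = 1%N -> F_spec r t' P' -> P' = 1.
  by move=> t01 [_ PE]; apply/eqP; rewrite -tofrac_eq PE tofrac1; case: t01 => ->.
have S0 : F_spec r 0 1 by split; [apply: one_mod_X1|rewrite tofrac1].
elim=> {t P} [|t IHt] P Q SP SQ.
  have P1 := F_spec1 _ _ (or_intror erefl) SP.
  have := F_spec_exchange S0 SP SQ; rewrite mulr1 P1 expr1n => ->.
  rewrite rmorph1 size_poly1; split=> //.
  rewrite rmorphD rmorph1 size_addl size_c_mon //= size_poly1 //.
have [P0 SP0] := F_spec_ex hr t.+1.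
have [s0 s1] := IHt _ _ SP0 SP; split=> //.
have P0n : to_poly2 P0 != 0 by rewrite -size_poly_eq0 s0.
have Pn : to_poly2 P != 0 by rewrite -size_poly_eq0 s1.
have Qn : to_poly2 Q != 0.
  rewrite -size_poly_gt0; apply: leq_ltn_trans (to_poly2_size (m := 0%MM) _) => //.
  by rewrite (one_mod_X_coef0 SQ.1) oner_eq0.
have E : to_poly2 Q * to_poly2 P0 = to_poly2 (c_mon r t.+1) + to_poly2 P ^+ r.
  by rewrite -rmorphM (F_spec_exchange SP0 SP SQ) rmorphD rmorphXn.
have := congr1 (fun p : {poly {poly rat}} => size p) E.
rewrite size_mul // s0.
have sPr : size (to_poly2 P ^+ r) = (r * u t.+1).+1.
  by rewrite -[LHS]prednK ?size_poly_gt0 ?expf_neq0 // size_exp s1 mulnC.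
have rec := chebyshev_rec hr t.
move=> sQ; suff sS : size (to_poly2 (c_mon r t.+1) + to_poly2 P ^+ r) = (r * u t.+1).+1.
  by rewrite sS addnS succnK -rec -addSn in sQ; apply: addIn sQ.
case: t => [|t] in SP SP0 SQ s0 s1 IHt E sPr rec sQ *; last first.
  rewrite addrC size_addl sPr // size_c_mon ltnS.
  by have := chebyshev_lt hr t; move: rec; lia.
(* for [t = 0] both terms have degree [r] in [y_1], but their leading coefficients
   are [y_2] and [1], which do not cancel *)
apply/eqP; rewrite eqn_leq; apply/andP; split.
  by rewrite (leq_trans (size_polyD _ _)) // sPr size_c_mon geq_max; move: rec; lia.
rewrite ltnNge; apply/negP => /leq_sizeP/(_ _ (leqnn _)).
have P1 : to_poly2 P = 'X - (-1)%:P.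
  have := F_spec_exchange S0 SP0 SP; rewrite mulr1 (F_spec1 _ _ _ SP0); last by right.
  by rewrite expr1n => ->; rewrite rmorphD rmorph1 to_poly2X !mnmE /= expr1 mulr1 polyCN opprK.
have mon : to_poly2 P ^+ r \is monic by rewrite P1 monic_exp // monicXsubC.
move/monicP: mon; rewrite lead_coefE sPr /= coefD => ->.
rewrite to_poly2X !mnmE /= !muln1 subn0 expr1 coefMC coefXn eqxx mul1r.
have -> : 'X + 1 = 'X - (-1)%:P :> {poly rat} by rewrite polyCN opprK.
by move/eqP; rewrite polyXsubC_eq0.
Qed.
End Degree.

(** * The limit *)

Section Sum.
Variable r : nat.
Hypothesis hr : (2 <= r)%N.
Local Notation u := (chebyshev r).

Definition words_at (N T : nat) (v : 'cV[int]_2) : seq (seq nat) :=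
  [seq w <- words N 0 T | exponent r w == v].

Definition word_bound (v : 'cV[int]_2) : nat := `|v vertex1 0|.+1.

(** The sum runs over all sorted words of exponent [v], whatever their norm; the
bound on the letters and the multiplicities only makes it finite. *)
Definition S_inf (v : 'cV[int]_2) : rat :=
  \sum_(w <- words_at (word_bound v) (word_bound v) v) term_coef r w.

Lemma exponent1 w : exponent r w vertex1 0 = \sum_(z <- w) (u z.+1)%:Z.
Proof. by rewrite exponentE // mxE. Qed.

Lemma exponent2 w : exponent r w vertex2 0 = \sum_(z <- w) (u z)%:Z.
Proof. by rewrite exponentE // mxE. Qed.

Lemma exponent_ge0 w i : 0 <= exponent r w i 0.
Proof.
move: i; apply: (alternating_ind (t := 0)); rewrite /alternating /= ?exponent1 ?exponent2;
by apply: sumr_ge0.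
Qed.

Lemma word_boundP w (v : 'cV[int]_2) : exponent r w = v ->
  (size w < word_bound v)%N /\ all (fun z => z < word_bound v)%N w.
Proof.
move=> <-; rewrite /word_bound exponent1 -(big_morph Posz PoszD (erefl 0%:Z)) absz_nat.
elim: w => [|z w [IH1 IH2]] //; rewrite big_cons.
move: (u z.+1) (chebyshev_ge hr z.+1) => c zc /=.
set s := (\sum_(_ <- _) _)%N in IH1 IH2 *.
split; first by move: IH1; lia.
apply/andP; split; first lia.
by apply: sub_all IH2 => y; lia.
Qed.

Lemma words_at_uniq N T v : uniq (words_at N T v).
Proof. by rewrite filter_uniq // words_uniq. Qed.

Lemma mem_words_at N T v w : (word_bound v <= N)%N -> (word_bound v <= T)%N ->
  (w \in words_at N T v) = sorted leq w && (exponent r w == v).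
Proof.
move=> vN vT; rewrite mem_filter andbC; case: eqP => [wv|]; last by rewrite !andbF.
rewrite !andbT; apply/idP/idP => [/words_sorted //|ws].
have [sw lw] := word_boundP wv.
apply: mem_words => //; first exact: leq_trans vN.
  by apply/allP.
by apply: sub_all lw => y /leq_trans; apply.
Qed.

Lemma sum_words_at N T v : (word_bound v <= N)%N -> (word_bound v <= T)%N ->
  \sum_(w <- words N 0 T | exponent r w == v) term_coef r w = S_inf v.
Proof.
move=> vN vT; rewrite -big_filter -/(words_at N T v); apply: perm_big.
by apply: uniq_perm => [||w]; rewrite ?words_at_uniq // !mem_words_at.
Qed.

Lemma S_inf_neg (v : 'cV[int]_2) : (exists i, v i 0 < 0) -> S_inf v = 0.
Proof.
move=> [i vi]; rewrite /S_inf /words_at (@eq_filter _ _ pred0) ?filter_pred0 ?big_nil // => w.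
by apply/eqP => wv; have := exponent_ge0 w i; rewrite wv leNgt vi.
Qed.

Lemma deformed_F_limit b : parity_limit b (deformed_F (kronecker r) alternating)
  (permute_vars (if b then 1%g else tperm vertex1 vertex2) S_inf).
Proof.
move=> v; exists (word_bound (row_perm (if b then 1%g else tperm vertex1 vertex2) v)).
case=> // T vT Tb.
set v' := row_perm _ v in vT *.
rewrite /permute_vars -/v'.
pose N := maxn (word_bound v') `|((C_matrix (kronecker r) alternating T.+1 *m v) vertex1 0)%R|.+1.
rewrite (@deformed_FE r hr T N) /parity_perm ?Tb -/v'; last by rewrite leq_max leqnn orbT.
by apply: sum_words_at => //; apply: leq_maxl.
Qed.

Lemma word_exp_eq T w w' :
  all (fun z => z < T.+1)%N w -> all (fun z => z < T.+1)%N w' ->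
  (word_exp r T.+1 w == word_exp r T.+1 w') = (exponent r w == exponent r w').
Proof.
move=> wT wT'; have E := word_expE hr wT; have E' := word_expE hr wT'.
apply/eqP/eqP => [H|H].
  move: E E'; rewrite H => -> /oppr_inj/(can_inj (mulKmx (C_matrix_unit hr T))).
  exact: (can_inj (parity_permK T.+1)).
rewrite -H -E in E'; apply/mnmP => i; have /colP/(_ i) := E'.
by rewrite !mxE => -[].
Qed.

(** A word [w] of exponent [v] turns [S_inf v] into the coefficient of [F_T] at
[word_exp T w], whose first entry is the left-hand side below; it cannot exceed the
degree. *)
Lemma S_inf_degree (v : 'cV[int]_2) T : S_inf v != 0 -> (word_bound v <= T)%N ->
  (u T)%:Z * v vertex1 0 - (u T.+1)%:Z * v vertex2 0 <= (u T)%:Z.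
Proof.
case: T => // T Sv vT.
have [w wv] : exists w, w \in words_at (word_bound v) T.+1 v.
  move: Sv; rewrite -(sum_words_at (leqnn _) vT) -big_filter -/(words_at _ _ _).
  by case: words_at => [|w s]; [rewrite big_nil eqxx|exists w; rewrite mem_head].
move: wv; rewrite mem_filter => /andP[/eqP wv /words_lt]; rewrite add0n => wT.
pose m := word_exp r T.+1 w.
pose N := maxn (word_bound v) (m vertex1).+1.
have [SP PE] := F_poly_spec hr T.+1.
have : (F_poly (kronecker r) alternating T.+1)@_m = S_inf v.
  rewrite (@F_poly_coef r hr T.+1 N) ?leq_maxr // -(@sum_words_at N T.+1) ?leq_maxl //.
  rewrite big_seq_cond [RHS]big_seq_cond; apply: eq_bigl => w'.
  apply: andb_id2l => /words_lt; rewrite add0n => wT'.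
  by rewrite word_exp_eq // wv.
move=> Em; have := @to_poly2_size (F_poly (kronecker r) alternating T.+1) m.
rewrite Em => /(_ Sv); rewrite (F_spec_size hr (conj SP PE)) ltnS => mT.
rewrite -wv exponent1 exponent2 !mulr_sumr -sumrB.
apply: le_trans (_ : (m vertex1)%:Z <= _); last by rewrite lez_nat.
rewrite /m /word_exp mnm_sumE (big_morph Posz PoszD (erefl 0%:Z)).
rewrite le_eqVlt; apply/orP; left; apply/eqP; apply: eq_big_seq => z /(allP wT) zT.
by rewrite mnmE eqxx chebyshev_det ?(ltnW zT) // -subSn.
Qed.
End Sum.

(** * Norms *)

Section Norms.
Variables (R : realType) (r : nat).
Hypothesis hr : (2 <= r)%N.
Local Notation u := (chebyshev r).
Local Notation p := (p_root R r).
Local Notation d := (Num.sqrt (r%:R ^+ 2 - 4) : R).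

Lemma disc_sqr : d ^+ 2 = r%:R ^+ 2 - 4.
Proof.
rewrite sqr_sqrtr // subr_ge0.
have : (2 : R) <= r%:R by rewrite ler_nat.
nra.
Qed.

Lemma p_conj : p * (r%:R - p) = 1.
Proof. by have := disc_sqr; rewrite /p_root; set s := d => h; field: h. Qed.

Lemma p_ge1 : 1 <= p.
Proof.
rewrite /p_root; have := sqrtr_ge0 (r%:R ^+ 2 - 4 : R); set s := d => h.
have : (2 : R) <= r%:R by rewrite ler_nat.
lra.
Qed.

Lemma p_gt0 : 0 < p.
Proof. exact: lt_le_trans ltr01 p_ge1. Qed.

Lemma p_inv_itv : 0 <= 1 / p <= 1.
Proof. by rewrite divr_ge0 ?ler01 ?(ltW p_gt0) //= ler_pdivrMr ?p_gt0 // mul1r p_ge1. Qed.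

Lemma p_inv : 1 / p = r%:R - p.
Proof.
have p0 : p != 0 by have := p_ge1; apply: contraTneq => ->; rewrite ler10.
by apply: (mulfI p0); rewrite p_conj mul1r mulfV.
Qed.

Lemma p_sub_inv : p - 1 / p = d.
Proof. by rewrite p_inv /p_root; field. Qed.

(** Here [x] and [y] are the two roots of [X ^ 2 - r X + 1], in either order. *)
Lemma chebyshev_eigen (x y : R) k : x * y = 1 -> x + y = r%:R ->
  (u k.+1)%:R - x * (u k)%:R = y ^+ k.
Proof.
move=> xy xyr; elim: k => [|k IHk]; first by rewrite /= mulr0 subr0 expr0.
have := chebyshev_rec hr k => /(congr1 (fun n => n%:R : R)).
rewrite natrD natrM => /(canRL (addrK _)) ->.
rewrite exprS -IHk -xyr mulrBr mulrA [y * x]mulrC xy; ring.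
Qed.

Lemma norm_at_exponent (x y : R) w : x * y = 1 -> x + y = r%:R ->
  norm_at y w = (exponent r w vertex1 0)%:~R - x * (exponent r w vertex2 0)%:~R.
Proof.
move=> xy xyr; rewrite (exponent1 hr) (exponent2 hr) !rmorph_sum mulr_sumr -sumrB.
by apply: eq_bigr => z _; rewrite -(chebyshev_eigen z xy xyr).
Qed.

Lemma norm_at_inv w : norm_at (1 / p) w =
  (exponent r w vertex1 0)%:~R - p * (exponent r w vertex2 0)%:~R.
Proof. by apply: norm_at_exponent; rewrite p_inv ?p_conj //; ring. Qed.

Lemma norm_at_p w : norm_at p w =
  (exponent r w vertex1 0)%:~R - 1 / p * (exponent r w vertex2 0)%:~R.
Proof. by apply: norm_at_exponent; rewrite p_inv; [rewrite mulrC p_conj|ring]. Qed.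

(** Divide the inequality of [S_inf_degree] by [u_T], which tends to infinity:
[u_(T+1) - p u_T = p ^ (- T)] stays bounded. *)
Lemma S_inf_support (v : 'cV[int]_2) : 1 < (v vertex1 0)%:~R - p * (v vertex2 0)%:~R -> S_inf r v = 0.
Proof.
set x := (v vertex1 0)%:~R; set y := (v vertex2 0)%:~R => xy.
apply/eqP/negPn/negP => Sv.
have e0 : 0 < x - p * y - 1 by rewrite subr_gt0.
pose T := maxn (word_bound v) (Num.bound (`|y| / (x - p * y - 1))).
have := S_inf_degree hr Sv (leq_maxl _ _ : (word_bound v <= T)%N).
rewrite -(ler_int R) rmorphB !rmorphM /= -/x -/y -!pmulrn => H.
have qk : (u T.+1)%:R = p * (u T)%:R + (1 / p) ^+ T.
  by rewrite -(@chebyshev_eigen p) ?p_inv ?p_conj //; ring.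
have /andP[q0 q1] : 0 <= (1 / p) ^+ T <= 1.
  by have /andP[q0 q1] := p_inv_itv; rewrite exprn_ge0 // exprn_ile1.
have uT : `|y| / (x - p * y - 1) < (u T)%:R.
  apply: lt_le_trans (archi_boundP _) _; first by rewrite divr_ge0 // ltW.
  rewrite ler_nat; apply: leq_trans (chebyshev_ge hr T); exact: leq_maxr.
rewrite ltr_pdivrMr // in uT.
rewrite qk in H.
have : (1 / p) ^+ T * y <= `|y|.
  apply: le_trans (ler_norm _) _; rewrite normrM (ger0_norm q0) ler_piMl //.
move=> Qy; suff : (u T)%:R + `|y| < (u T)%:R + `|y| by rewrite ltxx.
apply: (@lt_le_trans _ _ ((u T)%:R + (u T)%:R * (x - p * y - 1))); first by rewrite ltrD2l.
have expand (U s Q X Y : R) :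
  U + U * (X - s * Y - 1) = U * X - (s * U + Q) * Y + Q * Y by ring.
rewrite (expand _ _ ((1 / p) ^+ T)); exact: lerD H Qy.
Qed.

Lemma exponent_floorE w : (3 <= r)%N -> norm_at (1 / p) w <= 1 ->
  exponent_floor R r w = exponent r w.
Proof.
move=> r3 wW.
have d2 := disc_sqr.
have r3R : (3 : R) <= r%:R by rewrite ler_nat.
have d1 : 1 < d.
  have : 0 <= d by rewrite sqrtr_ge0.
  nra.
have d0 : d != 0 by rewrite gt_eqF // (lt_trans ltr01).
have p0 : p != 0 by rewrite gt_eqF // p_gt0.
have /andP[q0 q1] := p_inv_itv.
set n := norm_at (1 / p) w in wW.
have n0 : 0 <= n.
  by apply: sumr_ge0 => z _; rewrite exprn_ge0.
have nE : n = _ := norm_at_inv w; have NE := norm_at_p w.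
have ddE := p_sub_inv.
rewrite /exponent_floor.
set x := exponent r w vertex1 0 in nE NE; set y := exponent r w vertex2 0 in nE NE.
have E1 : p * norm_at p w / d = x%:~R + n / p / d.
  by apply: (mulIf d0); rewrite mulrDl !divfK // NE nE -ddE; field.
have E2 : norm_at p w / d = y%:~R + n / d.
  by apply: (mulIf d0); rewrite mulrDl !divfK // NE nE -ddE; field.
have nd : n / d < 1.
  by rewrite ltr_pdivrMr ?(lt_trans ltr01) // mul1r (le_lt_trans wW).
have np : n / p <= n by rewrite -[n / p]/(n * p^-1) -div1r ler_piMr.
have fl (a : int) (e : R) : 0 <= e -> e < 1 -> Num.floor (a%:~R + e) = a.
  move=> e0 e1; apply: floor_def; rewrite lerDl e0 /= intrD ltrD2l //.
rewrite E1 E2 !fl //.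
- apply/colP => i; rewrite mxE; move: i.
  by apply: (alternating_ind (t := 0)).
- by rewrite divr_ge0 // sqrtr_ge0.
- by apply: divr_ge0 (sqrtr_ge0 _); apply: divr_ge0 => //; exact: ltW p_gt0.
by apply: le_lt_trans nd; rewrite ler_pM2r // invr_gt0 (lt_trans ltr01).
Qed.

(** The condition defining [W] depends on the exponent only: for a given [v], either
all the words of exponent [v] belong to [W], or none of them does and [S_inf v]
vanishes. *)
Lemma formal_sum_S_inf e :
  (forall w, norm_at (1 / p) w <= 1 -> e w = exponent r w) ->
  is_formal_sum (W_set R r) (term_coef r) e (S_inf r).
Proof.
move=> eE v; pose L := words_at r (word_bound v) (word_bound v) v.
have WE w : (W_set R r `&` [set w | e w = v]) w <->
    (v vertex1 0)%:~R - p * (v vertex2 0)%:~R <= 1 :> R /\ w \in L.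
  rewrite mem_words_at // /W_set /=; split=> [[[ws wn] we]|[wn /andP[ws /eqP we]]].
    by rewrite -we (eE w wn) -norm_at_inv eqxx ws.
  by move: wn; rewrite -we -norm_at_inv => wn; rewrite (eE w wn).
have [v1|v1] := leP ((v vertex1 0)%:~R - p * (v vertex2 0)%:~R : R) 1.
  have -> : W_set R r `&` [set w | e w = v] = [set` L].
    apply/seteqP; split=> w; first by case/WE.
    by move=> wL; apply/WE; split.
  split; first exact: finite_seq.
  by rewrite -fsbig_seq // words_at_uniq.
have -> : W_set R r `&` [set w | e w = v] = set0.
  by apply/seteqP; split=> w //; case/WE; rewrite leNgt v1.
by rewrite fsbig_set0 S_inf_support.
Qed.
End Norms.

(** * The formulas for the limit *)

Theorem theorem7p5 (R : realType) (r : nat) (hr : (2 <= r)%N) :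
  forall b : bool, exists S : laurent 2,
    [/\ is_power_series S,
        parity_limit b (deformed_F (kronecker r) alternating) S,
        (exists sigma : 'S_2,
           is_formal_sum (W_set R r) (term_coef r) (exponent r)
             (permute_vars sigma S))
      & (3 <= r)%N ->
        exists sigma : 'S_2,
          is_formal_sum (W_set R r) (term_coef r) (exponent_floor R r)
            (permute_vars sigma S)].
Proof.
move=> b; pose s : 'S_2 := if b then 1%g else tperm vertex1 vertex2.
have sK : permute_vars s (permute_vars s (S_inf r)) = S_inf r.
  have := parity_permK b; rewrite /parity_perm oddb -/s => K.
  by apply/funext => v; rewrite /permute_vars; congr S_inf; exact: K.
exists (permute_vars s (S_inf r)); split.
- move=> v [i vi]; apply: (S_inf_neg hr); exists ((s^-1)%g i).
  by rewrite mxE permKV.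
- exact: deformed_F_limit.
- by exists s; rewrite sK; apply: formal_sum_S_inf.
by move=> r3; exists s; rewrite sK; apply: formal_sum_S_inf => // w; apply: exponent_floorE.
Qed.
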